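(* Let $X$ be a good topological space. If $X$ has the distinguished path property (dpp), then the universal cover $\widetilde{X}$ of $X$ is contractible and, in particular, $X$ is aspherical.
   Context: A space is good if it is path connected and admits a universal cover; equivalently, it is path connected, locally path connected and semilocally simply connected. An open subset $U\subseteq X$ is nice if it is path connected and the inclusion induces the trivial map $\pi_1(U,x)\to\pi_1(X,x)$ for every $x\in U$; in a good space the nice open sets form a basis of the topology. Let $I=[0,1]$ and let $X^I$ be the space of all continuous paths $I\to X$ with the compact-open topology. $\Pi(X)$ is the set of homotopy classes relative to endpoints $[\gamma]$ of paths $\gamma:I\to X$, with the topology having as basis the sets $S(U,V,[\gamma])=\{[\delta_1*\gamma*\delta_2]\}$, where $U,V\subseteq X$ are nice open sets, $\gamma$ is a path with $\gamma(0)\in U$ and $\gamma(1)\in V$, and $\delta_1$ (resp. $\delta_2$) ranges over the paths contained in $U$ ending at $\gamma(0)$ (resp. contained in $V$ starting at $\gamma(1)$); $*$ is concatenation. Let $q:X^I\to\Pi(X)$ be the quotient map $q(\gamma)=[\gamma]$. $X$ has the distinguished path property (dpp) if there is a continuous map $g:\Pi(X)\to X^I$ with $q\circ g=\mathrm{id}$ (such a $g$ is called a choice map). A space $X$ is aspherical if it is path connected and $\pi_n(X)=0$ for all $n\geq 2$. *)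

(* Defs.v *)
From HB Require Import structures.
From mathcomp Require Import all_boot all_order all_algebra generic_quotient.
From mathcomp Require Import all_classical all_reals all_analysis.
From mathcomp Require Import homotopy.
From mathcomp Require Import lra.

Set Implicit Arguments.
Unset Strict Implicit.
Unset Printing Implicit Defensive.

Import Order.TTheory GRing.Theory Num.Theory.
Import numFieldNormedType.Exports.

Local Open Scope classical_set_scope.
Local Open Scope ring_scope.
Local Open Scope quotient_scope.

Definition unitI (R : realType) : Type := set_type (`[0, 1]%classic : set R).

HB.instance Definition _ (R : realType) :=
  Topological.copy (unitI R) (set_type (`[0, 1]%classic : set R)).

Section unit_interval.
Context {R : realType}.
Implicit Types (r : R) (t : unitI R).

Definition unitv t : R := set_val t.

Let clamp_subproof r :
  Num.max 0 (Num.min 1 r) \in (`[0, 1]%classic : set R).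
Proof.
apply/mem_set; rewrite /= in_itv /= le_max lexx /= ge_max ler01 /=.
by rewrite ge_min lexx.
Qed.

(* The retraction of R onto [0, 1]; it only serves to write elements of [0, 1]
   without carrying membership proofs. *)
Definition clamp r : unitI R := SigSub (clamp_subproof r).

Lemma unitv_ge0 t : 0 <= unitv t.
Proof. by have := set_valP t; rewrite /= in_itv /= => /andP[]. Qed.

Lemma unitv_le1 t : unitv t <= 1.
Proof. by have := set_valP t; rewrite /= in_itv /= => /andP[]. Qed.

Lemma unitv_inj : injective unitv.
Proof. by move=> s t st; apply/val_inj. Qed.

Lemma unitv_clamp r : unitv (clamp r) = Num.max 0 (Num.min 1 r).
Proof. by []. Qed.

Lemma clampE r : 0 <= r <= 1 -> unitv (clamp r) = r.
Proof. by move=> /andP[r0 r1]; rewrite unitv_clamp min_r// max_r. Qed.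

Lemma clamp0 r : r <= 0 -> unitv (clamp r) = 0.
Proof.
by move=> r0; rewrite unitv_clamp min_r ?max_l// (le_trans r0) ?ler01.
Qed.

Lemma clamp1 r : 1 <= r -> unitv (clamp r) = 1.
Proof. by move=> r1; rewrite unitv_clamp min_l// max_r ?ler01. Qed.

Lemma clampK t : clamp (unitv t) = t.
Proof. by apply: unitv_inj; rewrite clampE// unitv_ge0 unitv_le1. Qed.

Lemma unitv_continuous : continuous unitv.
Proof. exact: initial_continuous. Qed.

Lemma clamp_continuous : continuous clamp.
Proof.
apply: continuous_comp_initial => x.
apply: (@continuous_max _ R (fun _ => 0) (fun r => Num.min 1 r)).
  exact: cvg_cst.
by apply: (@continuous_min _ R (fun _ => 1) id) => //; exact: cvg_cst.
Qed.

Let zero_one_neq : clamp 0 != clamp 1.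
Proof.
apply/eqP => /(congr1 unitv); rewrite !clampE ?lexx ?ler01//.
by move/eqP; rewrite eq_sym oner_eq0.
Qed.

HB.instance Definition _ := isBiPointed.Build (unitI R) zero_one_neq.

Lemma unitv0 : unitv zero = 0. Proof. by rewrite clamp0. Qed.
Lemma unitv1 : unitv one = 1. Proof. by rewrite clamp1. Qed.

End unit_interval.

Section continuity_tools.
Context {S T U : topologicalType}.

Lemma continuous_compf (f : S -> T) (g : T -> U) :
  continuous f -> continuous g -> continuous (fun x => g (f x)).
Proof. by move=> cf cg x; apply: continuous_comp; [exact: cf|exact: cg]. Qed.

Lemma continuous_pairf (f : S -> T) (g : S -> U) :
  continuous f -> continuous g -> continuous (fun x => (f x, g x)).
Proof. by move=> cf cg x; apply: cvg_pair; [exact: cf|exact: cg]. Qed.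

Lemma continuous_fst : continuous (fst : S * T -> S).
Proof. by move=> x; exact: cvg_fst. Qed.

Lemma continuous_snd : continuous (snd : S * T -> T).
Proof. by move=> x; exact: cvg_snd. Qed.

Lemma continuous_affine (R : realType) (phi : S -> R) (a b : R) :
  continuous phi -> continuous (fun x => a * phi x + b).
Proof.
move=> cphi x; apply: (@continuousD R R^o S (fun x => a * phi x) (cst b)).
  by apply: (@continuousM R S (cst a) phi); [exact: cvg_cst|exact: cphi].
exact: cvg_cst.
Qed.

Lemma continuous_glue (R : realType) (phi : S -> R) (c : R) (f g : S -> T) :
  continuous phi -> continuous f -> continuous g ->
  (forall x, phi x = c -> f x = g x) ->
  continuous (fun x => if phi x <= c then f x else g x).
Proof.
move=> cphi cf cg fg x; rewrite /continuous_at; have [phix|phix|phix] := ltgtP (phi x) c.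
- apply: (@cvg_trans _ (f @ x)); last exact: cf.
  apply: near_eq_cvg; near=> y; rewrite ifT//; apply/ltW; near: y.
  exact: (cvgr_lt _ (cphi x)).
- apply: (@cvg_trans _ (g @ x)); last exact: cg.
  apply: near_eq_cvg; near=> y; rewrite ifF//; apply/negbTE; rewrite -ltNge.
  by near: y; exact: (cvgr_gt _ (cphi x)).
- move=> A Afx; have Agx : nbhs (g x) A by rewrite -fg.
  have Hf : nbhs x (f @^-1` A) := cf x A Afx.
  have Hg : nbhs x (g @^-1` A) := cg x A Agx.
  by apply: filterS (filterI Hf Hg) => y [/= Af Ag]; case: ifP.
Unshelve. all: by end_near. Qed.

End continuity_tools.

Section interval_tools.
Context {R : realType} {S : topologicalType}.

Lemma continuous_clamp_affine (phi : S -> unitI R) (a b : R) :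
  continuous phi -> continuous (fun x => clamp (a * unitv (phi x) + b)).
Proof.
move=> cphi; apply: (continuous_compf _ (@clamp_continuous R)).
by apply: continuous_affine; exact: continuous_compf cphi (@unitv_continuous R).
Qed.

Lemma continuous_clamp2 (phi : S -> unitI R) :
  continuous phi -> continuous (fun x => clamp (2 * unitv (phi x))).
Proof.
move=> cphi; have := @continuous_clamp_affine phi 2 0 cphi.
by under eq_fun do rewrite addr0.
Qed.

Lemma continuous_clamp21 (phi : S -> unitI R) :
  continuous phi -> continuous (fun x => clamp (2 * unitv (phi x) - 1)).
Proof. exact: continuous_clamp_affine. Qed.

Lemma continuous_clampN (phi : S -> unitI R) :
  continuous phi -> continuous (fun x => clamp (1 - unitv (phi x))).
Proof.
move=> cphi; have := @continuous_clamp_affine phi (-1) 1 cphi.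
by under eq_fun do rewrite mulN1r addrC.
Qed.

End interval_tools.

Section homotopy.
Context (R : realType) {S T : topologicalType}.
Local Notation I := (unitI R).
Implicit Types (A : set S) (f g h : S -> T).

Definition homotopic_rel A f g : Prop := exists H : S * I -> T,
  [/\ continuous H, forall x, H (x, zero) = f x, forall x, H (x, one) = g x &
      forall x t, A x -> H (x, t) = f x].

Lemma homotopic_rel_refl A f : continuous f -> homotopic_rel A f f.
Proof.
by move=> cf; exists (fun p => f p.1); split => //;
  exact: continuous_compf continuous_fst cf.
Qed.

Lemma homotopic_rel_sym A f g : homotopic_rel A f g -> homotopic_rel A g f.
Proof.
move=> [H [cH H0 H1 HA]].
exists (fun p => H (p.1, clamp (1 - unitv p.2))); split => [|x|x|x t Ax] /=.
- apply: (continuous_compf _ cH); apply: continuous_pairf continuous_fst _.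
  exact: continuous_clampN continuous_snd.
- by rewrite unitv0 subr0 H1.
- by rewrite unitv1 subrr H0.
- by rewrite HA// -H1 HA.
Qed.

Lemma homotopic_rel_trans A f g h :
  homotopic_rel A f g -> homotopic_rel A g h -> homotopic_rel A f h.
Proof.
move=> [H [cH H0 H1 HA]] [K [cK K0 K1 KA]].
exists (fun p => if unitv p.2 <= 2^-1 then H (p.1, clamp (2 * unitv p.2))
                 else K (p.1, clamp (2 * unitv p.2 - 1))).
split => [|x|x|x t Ax] /=.
- apply: continuous_glue.
  + exact: continuous_compf continuous_snd (@unitv_continuous R).
  + apply: (continuous_compf _ cH); apply: continuous_pairf continuous_fst _.
    exact: continuous_clamp2 continuous_snd.
  + apply: (continuous_compf _ cK); apply: continuous_pairf continuous_fst _.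
    exact: continuous_clamp21 continuous_snd.
  + by move=> [x t] /= ->; rewrite divff// subrr H1 K0.
- by rewrite unitv0 invr_ge0 ler0n mulr0 H0.
- rewrite unitv1 ifF; last by apply/negbTE; rewrite -ltNge; lra.
  by rewrite mulr1 (_ : 2 - 1 = 1 :> R) ?K1//; lra.
- by case: ifP => _; rewrite ?HA// KA// -H1 HA.
Qed.

End homotopy.

Definition endpoints {R : realType} : set (unitI R) := [set zero; one].

Section path_space.
Context (R : realType) (X : topologicalType).
Local Notation I := (unitI R).

Definition path_space := continuousType I X.

HB.instance Definition _ := Topological.copy path_space
  (initial_topology (id : path_space -> {compact-open, I -> X})).

Definition path_homotopy (f g : path_space) : bool :=
  `[< homotopic_rel R endpoints f g >].

Let path_homotopy_refl : reflexive path_homotopy.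
Proof. by move=> f; apply/asboolP/homotopic_rel_refl; exact: cts_fun. Qed.

Let path_homotopy_sym : symmetric path_homotopy.
Proof. by move=> f g; apply/asboolP/asboolP; exact: homotopic_rel_sym. Qed.

Let path_homotopy_trans : transitive path_homotopy.
Proof.
move=> g f h /asboolP fg /asboolP gh; apply/asboolP.
exact: homotopic_rel_trans fg gh.
Qed.

Definition path_homotopy_equiv :=
  EquivRel path_homotopy path_homotopy_refl path_homotopy_sym
    path_homotopy_trans.

(* Pi(X) *)
Definition path_classes := {eq_quot path_homotopy_equiv}.

HB.instance Definition _ := Choice.on path_classes.
HB.instance Definition _ := Quotient.on path_classes.

Definition path_class (f : path_space) : path_classes := \pi_path_classes f.

Lemma path_classP (f g : path_space) :
  path_class f = path_class g <-> homotopic_rel R endpoints f g.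
Proof.
split=> [/eqmodP/asboolP//|fg]; apply/eqmodP; exact/asboolP.
Qed.

End path_space.

Arguments path_class {R X} f.

Section concat.
Context (R : realType) (X : topologicalType) (x y z : X).
Local Notation I := (unitI R).
Context (f : {path I from x to y}) (g : {path I from y to z}).

Definition concat (t : I) : X :=
  if unitv t <= 2^-1 then f (clamp (2 * unitv t))
  else g (clamp (2 * unitv t - 1)).

Let concat_continuous : continuous concat.
Proof.
have cid : continuous (@id I) by move=> t.
apply: continuous_glue; first exact: unitv_continuous.
- exact: continuous_compf (continuous_clamp2 cid) (@cts_fun _ _ f).
- exact: continuous_compf (continuous_clamp21 cid) (@cts_fun _ _ g).
- move=> t ->; rewrite divff// subrr.
  exact: etrans (@path_one _ _ _ _ f) (esym (@path_zero _ _ _ _ g)).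
Qed.

Let concat_zero : concat zero = x.
Proof. by rewrite /concat unitv0 invr_ge0 ler0n mulr0; exact: path_zero. Qed.

Let concat_one : concat one = z.
Proof.
rewrite /concat unitv1 ifF; last by apply/negbTE; rewrite -ltNge; lra.
by rewrite mulr1 (_ : 2 - 1 = 1 :> R); [exact: path_one|lra].
Qed.

HB.instance Definition _ := isContinuous.Build I X concat concat_continuous.
HB.instance Definition _ := isPath.Build I X x z concat concat_zero concat_one.

End concat.

Section good.
Context (R : realType) (X : topologicalType).
Local Notation I := (unitI R).

(* In particular a path connected set is nonempty. *)
Definition path_connected (U : set X) : Prop :=
  U !=set0 /\
  forall x y, U x -> U y -> exists f : {path I from x to y}, range f `<=` U.

(* The inclusion of U induces the trivial map pi_1(U, x) -> pi_1(X, x). *)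
Definition pi1_trivial_in (U : set X) (x : X) : Prop :=
  forall f : {path I from x to x}, range f `<=` U ->
    path_class f = path_class (cst x : path_space R X).

Definition nice (U : set X) : Prop :=
  [/\ open U, path_connected U & forall x, U x -> pi1_trivial_in U x].

Definition locally_path_connected : Prop :=
  forall (x : X) (U : set X), open U -> U x ->
    exists V, [/\ open V, V x, V `<=` U & path_connected V].

Definition semilocally_simply_connected : Prop :=
  forall x : X, exists U, [/\ open U, U x & pi1_trivial_in U x].

Definition good : Prop :=
  [/\ path_connected setT, locally_path_connected &
      semilocally_simply_connected].

End good.

Section Pi_topology.
Context (R : realType) (X : topologicalType).
Local Notation I := (unitI R).

(* The set S(U, V, [f]). *)
Definition Pi_basic (U V : set X) (x y : X) (f : {path I from x to y}) :
    set (path_classes R X) :=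
  [set a | exists u v (d1 : {path I from u to x}) (d2 : {path I from y to v}),
    [/\ range d1 `<=` U, range d2 `<=` V &
        a = path_class (concat (concat d1 f) d2)]].

Definition Pi_basics : set (set (path_classes R X)) :=
  [set B | exists U V x y (f : {path I from x to y}),
    [/\ nice R U, nice R V, U x, V y & B = Pi_basic U V f]].

(* Generated topology, so that no hypothesis on X is needed to declare the
   instance; Pi_basics_basis below shows that Pi_basics is a basis of it as soon
   as X is good. *)
HB.instance Definition _ :=
  isSubBaseTopological.Build (path_classes R X) Pi_basics id.

End Pi_topology.

Section path_algebra.
Context {R : realType} {X : topologicalType}.
Local Notation I := (unitI R).

Lemma path_class_endpoints (f g : path_space R X) :
  path_class f = path_class g -> f zero = g zero /\ f one = g one.
Proof.
move=> /path_classP[H [_ H0 H1 HA]].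
by rewrite -!H1 !HA//; [right|left].
Qed.

Lemma path_class_reparam (F f g : path_space R X) (phi psi : I -> I) :
  continuous phi -> continuous psi ->
  phi zero = psi zero -> phi one = psi one ->
  (forall t, f t = F (phi t)) -> (forall t, g t = F (psi t)) ->
  path_class f = path_class g.
Proof.
move=> cphi cpsi e0 e1 fE gE; apply/path_classP.
exists (fun p => F (clamp ((1 - unitv p.2) * unitv (phi p.1) +
                           unitv p.2 * unitv (psi p.1)))).
have c1 (h : I -> I) : continuous h ->
    continuous (fun p : I * I => unitv (h p.1)).
  move=> ch; apply: (continuous_compf _ (@unitv_continuous R)).
  exact: continuous_compf continuous_fst ch.
have c2 : continuous (fun p : I * I => unitv p.2).
  exact: continuous_compf continuous_snd (@unitv_continuous R).
split => [|t|t|t s].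
- apply: (continuous_compf _ (@cts_fun _ _ F)).
  apply: (continuous_compf _ (@clamp_continuous R)) => p.
  apply: (@continuousD R R^o (I * I)%type
    (fun p => (1 - unitv p.2) * unitv (phi p.1))
    (fun p => unitv p.2 * unitv (psi p.1))).
    apply: (@continuousM R (I * I)%type (fun p => 1 - unitv p.2)); last exact: c1.
    by apply: (@continuousB R R^o (I * I)%type (cst 1)); [exact: cvg_cst|exact: c2].
  by apply: (@continuousM R (I * I)%type (fun p => unitv p.2)); [exact: c2|exact: c1].
- by rewrite /= unitv0 subr0 mul1r mul0r addr0 clampK fE.
- by rewrite /= unitv1 subrr mul1r mul0r add0r clampK gE.
- by move=> [->|->] /=; rewrite ?e0 ?e1 -mulrDl subrK mul1r clampK fE ?e0 ?e1.
Qed.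

Lemma path_class_concat (x y z : X) (f f' : {path I from x to y})
    (g g' : {path I from y to z}) :
  path_class f = path_class f' -> path_class g = path_class g' ->
  path_class (concat f g) = path_class (concat f' g').
Proof.
move=> /path_classP[H [cH H0 H1 HA]] /path_classP[K [cK K0 K1 KA]].
apply/path_classP.
exists (fun p => if unitv p.1 <= 2^-1 then H (clamp (2 * unitv p.1), p.2)
                 else K (clamp (2 * unitv p.1 - 1), p.2)).
split => [|t|t|t s].
- apply: continuous_glue.
  + exact: continuous_compf continuous_fst (@unitv_continuous R).
  + apply: (continuous_compf _ cH); apply: continuous_pairf _ continuous_snd.
    exact: continuous_clamp2 continuous_fst.
  + apply: (continuous_compf _ cK); apply: continuous_pairf _ continuous_snd.
    exact: continuous_clamp21 continuous_fst.
  + move=> [t s] /= ->; rewrite divff// subrr HA; last by right.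
    rewrite KA; last by left.
    exact: etrans (@path_one _ _ _ _ f) (esym (@path_zero _ _ _ _ g)).
- by rewrite /= H0 K0.
- by rewrite /= H1 K1.
- move=> [->|->] /=; rewrite /concat.
    by rewrite unitv0 invr_ge0 ler0n mulr0; apply: HA; left.
  have -> : (unitv (one : I) <= 2^-1) = false.
    by rewrite unitv1; apply/negbTE; rewrite -ltNge; lra.
  by rewrite unitv1 mulr1 (_ : 2 - 1 = 1 :> R); [apply: KA; right|lra].
Qed.

Lemma range_concat (U : set X) (x y z : X) (f : {path I from x to y})
    (g : {path I from y to z}) :
  range f `<=` U -> range g `<=` U -> range (concat f g) `<=` U.
Proof.
move=> fU gU _ [t _ <-]; rewrite /concat.
by case: ifP => _; [apply: fU|apply: gU]; eexists.
Qed.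

Lemma concatA (x y z w : X) (f : {path I from x to y})
    (g : {path I from y to z}) (h : {path I from z to w}) :
  path_class (concat (concat f g) h) = path_class (concat f (concat g h)).
Proof.
pose psi (t : I) : I := if unitv t <= 2^-1 then clamp (2^-1 * unitv t + 0)
  else if unitv t <= 3/4 then clamp (1 * unitv t + - 4^-1)
  else clamp (2 * unitv t + - 1).
have cid : continuous (@id I) by move=> t.
apply: (@path_class_reparam (concat (concat f g) h) _ _ id psi) => //.
- apply: continuous_glue.
  + exact: unitv_continuous.
  + exact: continuous_clamp_affine.
  + apply: continuous_glue.
    * exact: unitv_continuous.
    * exact: continuous_clamp_affine.
    * exact: continuous_clamp_affine.
    * by move=> t ->; congr clamp; lra.
  + by move=> t ->; rewrite ifT; [congr clamp; lra|lra].
- by rewrite /psi unitv0 invr_ge0 ler0n mulr0 addr0.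
- rewrite /psi unitv1 !ifF; [|by apply/negbTE; rewrite -ltNge; lra..].
  by congr clamp; lra.
- move=> t; have t0 := unitv_ge0 t; have t1 := unitv_le1 t.
  rewrite /= /psi /concat /=. have [t2|t2] := leP (unitv t) 2^-1.
    rewrite clampE; last by apply/andP; split; lra.
    rewrite ifT /concat; last by lra.
    rewrite clampE; last by apply/andP; split; lra.
    by rewrite ifT; [congr (f (clamp _)); lra|lra].
  rewrite [in LHS]/concat [in LHS]clampE; last by apply/andP; split; lra.
  have [t3|t3] := leP (unitv t) (3/4).
    rewrite clampE; last by apply/andP; split; lra.
    rewrite ifT; last by lra.
    rewrite ifT; last by lra.
    rewrite /concat clampE; last by apply/andP; split; lra.
    rewrite ifF; last by apply/negbTE; rewrite -ltNge; lra.
    by congr (g (clamp _)); lra.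
  rewrite ifF; last by apply/negbTE; rewrite -ltNge; lra.
  rewrite clampE; last by apply/andP; split; lra.
  rewrite ifF; last by apply/negbTE; rewrite -ltNge; lra.
  by congr (h (clamp _)); lra.
Qed.

Lemma concat_cst_l (x y : X) (f : {path I from x to y}) :
  path_class (concat (cst x : {path I from x to x}) f) = path_class f.
Proof.
have cid : continuous (@id I) by move=> t.
apply: (@path_class_reparam f _ _ (fun t => clamp (2 * unitv t - 1)) id) => //.
- exact: continuous_clamp21.
- by apply: unitv_inj; rewrite unitv0 clamp0//; lra.
- by apply: unitv_inj; rewrite unitv1 clamp1//; lra.
- move=> t; rewrite /= /concat; case: ifP => // t2.
  have -> : clamp (2 * unitv t - 1) = zero :> I.
    by apply: unitv_inj; rewrite unitv0 clamp0//; lra.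
  by rewrite path_zero.
Qed.

Lemma concat_cst_r (x y : X) (f : {path I from x to y}) :
  path_class (concat f (cst y : {path I from y to y})) = path_class f.
Proof.
have cid : continuous (@id I) by move=> t.
apply: (@path_class_reparam f _ _ (fun t => clamp (2 * unitv t)) id) => //.
- exact: continuous_clamp2.
- by apply: unitv_inj; rewrite unitv0 clamp0//; lra.
- by apply: unitv_inj; rewrite unitv1 clamp1//; lra.
- move=> t; rewrite /= /concat; case: leP => // t2.
  have -> : clamp (2 * unitv t) = one :> I.
    by apply: unitv_inj; rewrite unitv1 clamp1//; lra.
  by rewrite path_one.
Qed.

Section reverse.
Context (x y : X) (f : {path I from x to y}).

Definition rev_path (t : I) : X := f (clamp (1 - unitv t)).

Let rev_continuous : continuous rev_path.
Proof.
have cid : continuous (@id I) by move=> t.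
exact: continuous_compf (continuous_clampN cid) (@cts_fun _ _ f).
Qed.

Let rev_zero : rev_path zero = y.
Proof. by rewrite /rev_path unitv0 subr0; exact: path_one. Qed.

Let rev_one : rev_path one = x.
Proof. by rewrite /rev_path unitv1 subrr; exact: path_zero. Qed.

HB.instance Definition _ := isContinuous.Build I X rev_path rev_continuous.
HB.instance Definition _ := isPath.Build I X y x rev_path rev_zero rev_one.

Lemma concat_rev :
  path_class (concat rev_path f) = path_class (cst y : path_space R X).
Proof.
have cid : continuous (@id I) by move=> t.
apply: (@path_class_reparam f _ _ (fun t => if unitv t <= 2^-1
  then clamp (- 2 * unitv t + 1) else clamp (2 * unitv t - 1)) (cst one)) => //.
- apply: continuous_glue.
  + exact: unitv_continuous.
  + exact: continuous_clamp_affine.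
  + exact: continuous_clamp21.
  + by move=> t ->; congr clamp; lra.
- exact: cst_continuous.
- by rewrite unitv0 invr_ge0 ler0n mulr0 add0r.
- rewrite unitv1 ifF; last by apply/negbTE; rewrite -ltNge; lra.
  by congr clamp; lra.
- move=> t; have t0 := unitv_ge0 t; have t1 := unitv_le1 t.
  rewrite /= /concat; case: ifP => t2; last by [].
  transitivity (f (clamp (1 - unitv (clamp (2 * unitv t))))) => //.
  rewrite clampE; last by apply/andP; split; lra.
  by congr (f (clamp _)); lra.
- by move=> t; rewrite /= path_one.
Qed.

End reverse.
End path_algebra.

Section Pi_basis.
Context (R : realType) (X : topologicalType).
Local Notation I := (unitI R).

Lemma good_nice (x : X) (U : set X) : good R X -> open U -> U x ->
  exists V, [/\ nice R V, V x & V `<=` U].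
Proof.
move=> [_ lpc slsc] oU Ux.
have [N [oN Nx Nt]] := slsc x.
have [V [oV Vx VUN Vc]] := lpc x (U `&` N) (openI oU oN) (conj Ux Nx).
exists V; split => //; last by move=> y /VUN[].
split=> // y Vy l lV.
have [p pV] := Vc.2 _ _ Vx Vy.
have rV : range (rev_path p) `<=` V.
  by move=> _ [t _ <-]; apply: pV; eexists.
have /Nt e : range (concat (concat p l) (rev_path p)) `<=` N.
  have VN : V `<=` N by move=> z /VUN[].
  by apply: range_concat (subset_trans rV VN); apply: range_concat;
    exact: (subset_trans _ VN).
have H1 : path_class (concat (rev_path p)
    (concat (concat (concat p l) (rev_path p)) p)) = path_class l.
  transitivity (path_class (concat (rev_path p) (concat p l))).
    apply: path_class_concat => //; rewrite concatA -[RHS]concat_cst_r.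
    by apply: path_class_concat => //; exact: concat_rev.
  rewrite -concatA -[RHS]concat_cst_l.
  by apply: path_class_concat => //; exact: concat_rev.
rewrite -H1 -(concat_rev p); apply: path_class_concat => //.
by rewrite -[RHS]concat_cst_l; apply: path_class_concat.
Qed.

Lemma Pi_basic_sub (U V W Z : set X) (x y u v : X) (f : {path I from x to y})
    (h : {path I from u to v}) :
  W `<=` U -> Z `<=` V -> Pi_basic U V f (path_class h) ->
  Pi_basic W Z h `<=` Pi_basic U V f.
Proof.
move=> WU ZV [u' [v' [e1 [e2 [e1U e2V he]]]]].
have [hu hv] := path_class_endpoints he.
rewrite /= !path_zero !path_one in hu hv; subst u' v'.
move=> _ [u' [v' [d1 [d2 [d1W d2Z ->]]]]].
exists u', v', (concat d1 e1), (concat e2 d2); split.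
- by apply: range_concat => //; exact: subset_trans WU.
- by apply: range_concat => //; exact: subset_trans ZV.
- transitivity (path_class (concat (concat d1 (concat (concat e1 f) e2)) d2)).
    by apply: path_class_concat => //; exact: path_class_concat.
  rewrite -concatA; apply: path_class_concat => //.
  rewrite -concatA; apply: path_class_concat => //.
  by rewrite -concatA.
Qed.

Lemma Pi_basic_refl (U V : set X) (x y : X) (f : {path I from x to y}) :
  U x -> V y -> Pi_basic U V f (path_class f).
Proof.
move=> Ux Vy.
exists x, y, (cst x : {path I from x to x}), (cst y : {path I from y to y}).
split; first by move=> _ [t _ <-].
  by move=> _ [t _ <-].
by rewrite concat_cst_r concat_cst_l.
Qed.

Lemma path_classes_ind (P : path_classes R X -> Prop) :
  (forall x y (f : {path I from x to y}), P (path_class f)) -> forall a, P a.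
Proof.
move=> Pf a; rewrite -[a]reprK; set h := repr a.
have -> : \pi_(path_classes R X) h =
    path_class (mk_path (@cts_fun _ _ h) erefl erefl).
  by apply/path_classP/homotopic_rel_refl; exact: cts_fun.
exact: Pf.
Qed.

Lemma Pi_basics_basis : good R X -> basis (@Pi_basics R X).
Proof.
move=> gX; split.
  move=> B BB; exists [set B]; last by rewrite bigcup_set1.
  by move=> _ ->; exact: (@finI_from1 _ _ _ id).
elim/path_classes_ind => x y f A; rewrite nbhsE => -[_ [[D' D'sub <-]]].
move=> [C D'C Cf] CA.
have [s [sB sf sA]] : exists s : seq (set (path_classes R X)),
    [/\ forall i, i \in s -> Pi_basics i,
        forall i, i \in s -> i (path_class f) &
        forall a, (forall i, i \in s -> i a) -> A a].
  have [E EB EC] := D'sub _ D'C; subst C.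
  exists (finmap.enum_fset E); split => [i iE|i iE|a aE].
  - by have := EB i iE; rewrite inE.
  - exact: Cf.
  - by apply: CA; eexists; [exact: D'C|exact: aE].
suff [K [BK Kf KE]] : exists K, [/\ Pi_basics K, K (path_class f) &
    forall i, i \in s -> K `<=` i].
  by exists K => // a Ka; apply: sA => i si; exact: KE i si a Ka.
elim: s sB sf {sA} => [|B s IH] sB sf.
  have [U [nU Ux _]] := good_nice gX (openT : open [set: X]) (Logic.I : [set: X] x).
  have [V [nV Vy _]] := good_nice gX (openT : open [set: X]) (Logic.I : [set: X] y).
  exists (Pi_basic U V f); split => //; last exact: Pi_basic_refl.
  by exists U, V, x, y, f.
have [i si|i si|K [BK Kf Ks]] := IH.
- by apply: sB; rewrite inE si orbT.
- by apply: sf; rewrite inE si orbT.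
have := sB B (mem_head _ _); have := sf B (mem_head _ _).
move=> Bf [U1 [V1 [x1 [y1 [f1 [nU1 nV1 _ _ BE]]]]]]; subst B.
move: BK Kf Ks => [U2 [V2 [x2 [y2 [f2 [nU2 nV2 _ _ ->]]]]]] Kf Ks.
have ends U V u v (h : {path I from u to v}) :
    Pi_basic U V h (path_class f) -> U x /\ V y.
  move=> [u' [v' [d1 [d2 [d1U d2V fE]]]]].
  have [] := path_class_endpoints fE; rewrite /= !path_zero !path_one => -> ->.
  by split; [apply: d1U; exists zero; rewrite ?path_zero|
             apply: d2V; exists one; rewrite ?path_one].
have [U1x V1y] := ends _ _ _ _ _ Bf; have [U2x V2y] := ends _ _ _ _ _ Kf.
have oU : open (U1 `&` U2) by apply: openI; [case: nU1|case: nU2].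
have oV : open (V1 `&` V2) by apply: openI; [case: nV1|case: nV2].
have [U [nU Ux UU]] := good_nice gX oU (conj U1x U2x).
have [V [nV Vy VV]] := good_nice gX oV (conj V1y V2y).
exists (Pi_basic U V f); split.
- by exists U, V, x, y, f.
- exact: Pi_basic_refl.
- move=> i; rewrite inE => /predU1P[->|/Ks].
    apply: Pi_basic_sub Bf; last by move=> z /VV[].
    by move=> z /UU[].
  apply: subset_trans; apply: Pi_basic_sub Kf; last by move=> z /VV[].
  by move=> z /UU[].
Qed.

End Pi_basis.

Section statement_notions.
Context (R : realType).
Local Notation I := (unitI R).

(* Distinguished path property. *)
Definition dpp (X : topologicalType) : Prop :=
  exists g : path_classes R X -> path_space R X,
    continuous g /\ cancel g path_class.

Definition contractible (X : topologicalType) : Prop :=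
  exists x : X, homotopic_rel R set0 (@id X) (cst x).

Definition simply_connected (X : topologicalType) : Prop :=
  path_connected R [set: X] /\ forall x : X, pi1_trivial_in R setT x.

(* The inverse s of the homeomorphism p : V -> U is a total function, with
   irrelevant values outside U. *)
Definition homeo_on (E X : topologicalType) (p : E -> X) (V : set E)
    (U : set X) : Prop :=
  {within V, continuous p} /\
  exists s : X -> E, [/\ {within U, continuous s}, p @` V `<=` U,
    s @` U `<=` V, forall e, V e -> s (p e) = e & forall x, U x -> p (s x) = x].

Definition evenly_covered (E X : topologicalType) (p : E -> X)
    (U : set X) : Prop :=
  exists F : set (set E),
    [/\ p @^-1` U = \bigcup_(V in F) V, trivIset F id,
        forall V, F V -> open V & forall V, F V -> homeo_on p V U].

Definition covering_map (E X : topologicalType) (p : E -> X) : Prop :=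
  [/\ continuous p, range p = setT &
      forall x, exists U, [/\ open U, U x & evenly_covered p U]].

Definition universal_cover (E X : topologicalType) (p : E -> X) : Prop :=
  covering_map p /\ simply_connected E.

Definition cube (n : nat) : Type := prod_topology (fun _ : 'I_n => I).

HB.instance Definition _ n :=
  Topological.copy (cube n) (prod_topology (fun _ : 'I_n => I)).

Definition cube_boundary (n : nat) : set (cube n) :=
  [set y | exists i, y i = zero \/ y i = one].

Section homotopy_group.
Context (n : nat) (X : topologicalType) (x : X).

(* Continuous maps of pairs (I^n, boundary of I^n) -> (X, x). *)
Definition cube_map : Type :=
  {f : continuousType (cube n) X | `[< forall y, cube_boundary y -> f y = x >]}.

HB.instance Definition _ := Choice.on cube_map.

Definition cube_map_homotopy (f g : cube_map) : bool :=
  `[< homotopic_rel R (@cube_boundary n) (val f) (val g) >].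

Let cube_map_homotopy_refl : reflexive cube_map_homotopy.
Proof. by move=> f; apply/asboolP/homotopic_rel_refl; exact: cts_fun. Qed.

Let cube_map_homotopy_sym : symmetric cube_map_homotopy.
Proof. by move=> f g; apply/asboolP/asboolP; exact: homotopic_rel_sym. Qed.

Let cube_map_homotopy_trans : transitive cube_map_homotopy.
Proof.
move=> g f h /asboolP fg /asboolP gh; apply/asboolP.
exact: homotopic_rel_trans fg gh.
Qed.

Definition cube_map_homotopy_equiv :=
  EquivRel cube_map_homotopy cube_map_homotopy_refl cube_map_homotopy_sym
    cube_map_homotopy_trans.

(* The underlying pointed set of pi_n(X, x); the group law plays no role in
   its vanishing. *)
Definition homotopy_group := {eq_quot cube_map_homotopy_equiv}.

Let cst_subproof :
  `[< forall y, @cube_boundary n y -> (cst x : cube n -> X) y = x >].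
Proof. exact/asboolP. Qed.

Definition homotopy_group_one : homotopy_group :=
  \pi_homotopy_group (exist _ (cst x : continuousType (cube n) X) cst_subproof).

Definition homotopy_group_trivial : Prop :=
  forall a : homotopy_group, a = homotopy_group_one.

End homotopy_group.

Definition aspherical (X : topologicalType) : Prop :=
  path_connected R [set: X] /\
  forall n (x : X), (2 <= n)%N -> homotopy_group_trivial n x.

End statement_notions.

(* Main.v *)
(* A choice map g turns a continuous family of path classes a : C -> Pi(X) into
   a homotopy (c, t) |-> g (a c) t.  On a universal cover E, take for a e the
   class of the image of the paths from a base point e0 to e: the homotopy runs
   from a constant to the covering map, and its lift contracts E.  For
   f : I^n -> X, take for a c the class of the image of the segment from a
   corner to c: this is a homotopy from a constant to f.  When n >= 2, all
   boundary points have a c = 1, as the boundary is connected, so they all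
   follow the same loop g 1; this loop is null-homotopic, and a null-homotopy of
   it, spread over a collar of the cube, makes the homotopy relative to the
   boundary.  No cover of X is used there. *)
Require Import Defs.
From mathcomp Require Import all_boot all_order all_algebra generic_quotient.
From mathcomp Require Import all_classical all_reals all_analysis.
From mathcomp Require Import homotopy lra.

Set Implicit Arguments.
Unset Strict Implicit.
Unset Printing Implicit Defensive.

Import Order.TTheory GRing.Theory Num.Theory.
Import numFieldNormedType.Exports.

Local Open Scope classical_set_scope.
Local Open Scope ring_scope.

(** * Connectedness of the real line and slices of products *)

(** The set of points satisfying [P] is open and closed in the connected space [R]. This is the
    induction along the line behind both the uniqueness and the existence of lifts. *)
Lemma locally_constant_prop (R : realType) (P : R -> Prop) :
  (forall r, \forall s \near r, P s <-> P r) -> forall r s, P r -> P s.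
Proof.
move=> lcP r s Pr.
have cT : connected [set: R] by apply/connected_intervalP.
have oP : open [set x | P x].
  by rewrite openE => x Px; apply: filterS (lcP x) => y /= ->.
have cP : closed [set x | P x].
  rewrite -[X in closed X]setCK; apply: open_closedC; rewrite openE => x nPx.
  by apply: filterS (lcP x) => y /= ->.
have PT : [set x | P x] = setT.
  apply: cT; first by exists r.
  - by exists [set x | P x] => //; rewrite setTI.
  - by exists [set x | P x] => //; rewrite setTI.
by have : [set x | P x] s by rewrite PT.
Qed.

Lemma continuous_pair_left (S T : topologicalType) (y : T) :
  continuous (fun x : S => (x, y)).
Proof.
by apply: (continuous_pairf (f := id) (g := cst y)) => ?;
  [exact: cvg_id|exact: cvg_cst].
Qed.

Lemma continuous_pair_right (S T : topologicalType) (x : S) :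
  continuous (fun y : T => (x, y)).
Proof.
by apply: (continuous_pairf (f := cst x) (g := id)) => ?;
  [exact: cvg_cst|exact: cvg_id].
Qed.

(** * Compactness of the unit interval and evaluation of paths *)

Section unit_interval_topology.
Context {R : realType}.
Local Notation I := (unitI R).

Lemma compact_unitI : compact [set: I].
Proof.
have <- : @clamp R @` `[0, 1] = setT.
  rewrite eqEsubset; split=> // t _; exists (unitv t); last exact: clampK.
  by rewrite /= in_itv /= unitv_ge0 unitv_le1.
apply: continuous_compact; last exact: segment_compact.
exact/continuous_subspaceT/clamp_continuous.
Qed.

Lemma hausdorff_unitI : hausdorff_space I.
Proof.
move=> s t st; apply: unitv_inj; apply: Rhausdorff => A B As Bt.
have [u [Au Bu]] :=
  st _ _ (@unitv_continuous R s _ As) (@unitv_continuous R t _ Bt).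
by exists (unitv u).
Qed.

Lemma locally_compact_unitI : locally_compact [set: I].
Proof.
move=> t _; exists setT; first exact: filterT.
by split; [exact: compact_unitI | exact: closedT].
Qed.

(** Uncurrying is legitimate because [I] is locally compact and Hausdorff. This is what turns a
    choice map composed with a family of classes into a homotopy. *)
Lemma continuous_path_eval (T X : topologicalType) (g : T -> path_space R X) :
  continuous g -> continuous (fun p : T * I => g p.1 p.2).
Proof.
move=> cg.
have cg' : continuous (fun x => g x : {compact-open, I -> X}).
  move=> x; apply: continuous_comp; first exact: cg.
  exact: initial_continuous.
have /= := continuous_uncurry locally_compact_unitI hausdorff_unitI cg'
  (fun u => @cts_fun _ _ (g u)).
rewrite (_ : uncurry _ = (fun p : T * I => g p.1 p.2)) //.
by apply/funext => -[].
Qed.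

End unit_interval_topology.

(** * Classes of image paths *)

Lemma eq_path_class (R : realType) (X : topologicalType)
    (d e : path_space R X) : d =1 e -> path_class d = path_class e.
Proof.
move=> de; apply/path_classP; rewrite (_ : (d : _ -> _) = e); last exact/funext.
exact/homotopic_rel_refl/cts_fun.
Qed.

Section path_maps.
Context {R : realType} {C X : topologicalType} (f : C -> X) (cf : continuous f).
Local Notation I := (unitI R).

Definition image_path (x y : C) (d : {path I from x to y}) :
    {path I from f x to f y} :=
  mk_path (continuous_compf (@cts_fun _ _ d) cf)
    (congr1 f (@path_zero _ _ _ _ d)) (congr1 f (@path_one _ _ _ _ d)).

Lemma range_image_path (x y : C) (d : {path I from x to y}) (V : set X) :
  range d `<=` f @^-1` V -> range (image_path d) `<=` V.
Proof. by move=> dV _ [t _ <-]; apply: dV; exists t. Qed.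

Lemma image_path_class (x y : C) (d d' : {path I from x to y}) :
  path_class d = path_class d' ->
  path_class (image_path d) = path_class (image_path d').
Proof.
move=> /path_classP[H [cH H0 H1 HA]]; apply/path_classP.
exists (f \o H); split => [|t|t|t s At] /=.
- exact: continuous_compf cH cf.
- by rewrite H0.
- by rewrite H1.
- by rewrite HA.
Qed.

Lemma image_path_concat (x y z : C) (d : {path I from x to y})
    (e : {path I from y to z}) :
  path_class (image_path (concat d e)) =
  path_class (concat (image_path d) (image_path e)).
Proof.
by apply: eq_path_class => t; rewrite /= /mk_path /concat /=; case: ifP.
Qed.

(** The paths [gam c] are chosen without any continuity in [c]; only the class of their image
    matters. For [c'] near [c], that class is the one of [gam c] followed by a short path, and such
    an extension stays in a basic neighbourhood. *)
Lemma continuous_path_class (c0 : C) (gam : forall c, {path I from c0 to c}) :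
  good R X ->
  (forall c (d d' : {path I from c0 to c}),
     path_class (image_path d) = path_class (image_path d')) ->
  (forall c (O : set C), nbhs c O ->
     \forall c' \near c, exists d : {path I from c to c'}, range d `<=` O) ->
  continuous (fun c => path_class (image_path (gam c))).
Proof.
move=> gX f1 lpcC c A /(Pi_basics_basis gX).2 [B [BB Bc] BA].
move: BB Bc BA => [U [V [x [y [h [_ [oV _ _] _ _ ->]]]]]] Bc BA.
have Vfc : V (f c).
  have [u [v [d1 [d2 [_ d2V e]]]]] := Bc.
  have [_] := path_class_endpoints e; rewrite /= /mk_path !path_one => ->.
  by apply: d2V; exists one => //; rewrite path_one.
have nV : nbhs c (f @^-1` V) by apply: cf; exact: open_nbhs_nbhs.
apply: filterS (lpcC c _ nV) => c' [d dV]; apply: BA.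
apply: (Pi_basic_sub (@subset_refl _ U) (@subset_refl _ V) Bc).
(* Nothing is prepended, and the image of the short path [d], which lies in [V], is appended. *)
exists (f c0), (f c'), (cst (f c0) : {path I from f c0 to f c0}),
  (image_path d).
split; last 2 first.
- exact: range_image_path.
- rewrite (f1 _ _ (concat (gam c) d)) image_path_concat.
  by apply: path_class_concat => //; rewrite concat_cst_l.
move=> _ [t _ <-] /=.
have [u [v [d1 [d2 [d1U _ e]]]]] := Bc.
have [+ _] := path_class_endpoints e; rewrite /= /mk_path !path_zero => ->.
by apply: d1U; exists zero => //; rewrite path_zero.
Qed.

End path_maps.

(** Insert the reverse of [d'] followed by [d'] after [d]: the loop formed by [d] and the reverse of
    [d'] is trivial, which leaves [d']. *)
Lemma pi1_trivial_path_class (R : realType) (X : topologicalType) (x y : X)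
    (d d' : {path unitI R from x to y}) :
  pi1_trivial_in R setT x -> path_class d = path_class d'.
Proof.
move=> x1; have loop := x1 (concat d (Defs.rev_path d')) (@subsetT _ _).
rewrite -[LHS]concat_cst_r -[RHS]concat_cst_l.
transitivity (path_class (concat d (concat (Defs.rev_path d') d'))).
  by apply: path_class_concat => //; rewrite concat_rev.
by rewrite -concatA; exact: path_class_concat.
Qed.

(** * Lifting along covering maps *)

(** Each piece has to be continuous at [x] only if [x] lies on its side; this suits the local
    inverses of a covering, which are controlled only over [U]. *)
Lemma continuous_at_glue (R : realType) (S T : topologicalType) (phi : S -> R)
    (c : R) (f g : S -> T) (x : S) :
  {for x, continuous phi} ->
  (phi x <= c -> {for x, continuous f}) ->
  (c <= phi x -> {for x, continuous g}) ->
  (phi x = c -> f x = g x) ->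
  {for x, continuous (fun y => if phi y <= c then f y else g y)}.
Proof.
move=> cphi cf cg fg; rewrite /prop_for /continuous_at.
have [phix|phix|phix] := ltgtP (phi x) c.
- apply: (@cvg_trans _ (f @ x)); last exact/cf/ltW.
  apply: near_eq_cvg; near=> y; rewrite ifT//; apply/ltW; near: y.
  exact: (cvgr_lt _ cphi).
- apply: (@cvg_trans _ (g @ x)); last exact/cg/ltW.
  apply: near_eq_cvg; near=> y; rewrite ifF//; apply/negbTE; rewrite -ltNge.
  by near: y; exact: (cvgr_gt _ cphi).
- move=> A Afx; have Agx : nbhs (g x) A by rewrite -fg.
  have Hf : nbhs x (f @^-1` A) by apply: cf => //; rewrite phix.
  have Hg : nbhs x (g @^-1` A) by apply: cg => //; rewrite phix.
  by apply: filterS (filterI Hf Hg) => y [/= Af Ag]; case: ifP.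
Unshelve. all: by end_near. Qed.

Section covering.
Context {E X : topologicalType} (p : E -> X) (covp : covering_map p).

(** [F] is the family of sheets over [U], and [s] inverts [p] on the sheet [V]. As [U] is open,
    continuity within [U] is continuity at each point of [U]. *)
Lemma covering_sheets (x : X) : exists (U : set X) (F : set (set E)),
  [/\ open U, U x, forall e, U (p e) -> exists2 V, F V & V e,
      forall V W e, F V -> F W -> V e -> W e -> V = W &
      forall V, F V -> open V /\ exists s : X -> E,
        [/\ forall y, U y -> {for y, continuous s}, forall y, U y -> V (s y),
            forall e, V e -> s (p e) = e & forall y, U y -> p (s y) = y]].
Proof.
have [_ _ /(_ x)[U [oU Ux [F [pU tF oF hF]]]]] := covp.
exists U, F; split => // [e Upe|V W e FV FW Ve We|V FV].
- have : (p @^-1` U) e by [].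
  by rewrite pU => -[V FV Ve]; exists V.
- by apply: (tF V W FV FW); exists e.
- split; first exact: oF.
  have [_ [s [cs _ sU sp ps]]] := hF _ FV; exists s; split => // y Uy.
    by move: cs; rewrite continuous_open_subspace// => /(_ y (mem_set Uy)).
  by apply: sU; exists y.
Qed.

(** Agreement is locally constant: near [r] the lifts stay in sheets [V] and [W], and they agree at
    a point exactly when [V = W], because distinct sheets are disjoint and [p] is injective on
    each. *)
Lemma covering_line_lift_unique (R : realType) (a b : R -> E) :
  continuous a -> continuous b -> p \o a =1 p \o b -> a 0 = b 0 -> a =1 b.
Proof.
move=> ca cb pab ab0 t.
apply: (@locally_constant_prop R (fun r => a r = b r)) ab0 => r.
have [U [F [oU Ux cF tF hF]]] := covering_sheets (p (a r)).
have [V FV Var] := cF (a r) Ux.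
have [W FW Wbr] : exists2 W, F W & W (b r).
  by apply: cF; move: (pab r) => /= <-.
have [oV [s [_ _ sp _]]] := hF _ FV.
have [oW _] := hF _ FW.
have abVW u : V (a u) -> W (b u) -> a u = b u <-> V = W.
  move=> Vau Wbu; split=> [abu|VW].
    by apply: (tF _ _ (a u)) => //; rewrite abu.
  rewrite -(sp _ Vau) -[RHS]sp ?VW//; congr s; exact: pab.
have nV : nbhs r (a @^-1` V) by apply: ca; exact: open_nbhs_nbhs.
have nW : nbhs r (b @^-1` W) by apply: cb; exact: open_nbhs_nbhs.
apply: filterS (filterI nV nW) => u [Vau Wbu].
by rewrite (abVW u)// (abVW r).
Qed.

(** * Existence of lifts of homotopies *)

Section homotopy_lifting.
Context (R : realType) (Y : topologicalType) (H : Y * R -> X) (h0 : Y -> E).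
Hypotheses (cH : continuous H) (ch0 : continuous h0)
  (ph0 : forall y r, r <= 0 -> p (h0 y) = H (y, r)).

(* Over a neighbourhood of y, the homotopy stopped at time r lifts. *)
Let stopped_lift (y : Y) (r : R) : Prop := exists (N : set Y) (L : Y * R -> E),
  [/\ open N, N y, forall y', N y' -> L (y', 0) = h0 y' &
      forall z, N z.1 -> p (L z) = H (z.1, Num.min z.2 r) /\
                         {for z, continuous L}].

Let continuous_stop (r : R) :
  continuous (fun z : Y * R => (z.1, Num.min z.2 r)).
Proof.
apply: continuous_pairf; first exact: continuous_fst.
move=> z; apply: (@continuous_min _ (Y * R)%type snd (fun _ => r)).
  exact: cvg_snd.
exact: cvg_cst.
Qed.

(** Stop the lift itself at time [t']. *)
Let stopped_lift_le (y : Y) (t' t : R) : 0 <= t' -> t' <= t ->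
  stopped_lift y t -> stopped_lift y t'.
Proof.
move=> t0 tt [N [L [oN Ny L0 HL]]].
exists N, (fun z => L (z.1, Num.min z.2 t')); split=> // [y' Ny'|z Nz] /=.
  by rewrite min_l//; exact: L0.
have [/= -> cL] := HL (z.1, Num.min z.2 t') Nz; split.
  by rewrite -minA (min_l tt).
by apply: continuous_comp => //; exact: continuous_stop.
Qed.

(** After time [t], continue with the inverse of [p] on the sheet [V] containing [L (y, t)].
    Shrinking [N] so that [L (y', t)] stays in [V] makes the two pieces agree at time [t]. *)
Let stopped_lift_extend (y : Y) (U : set X) (F : set (set E)) (A : set Y)
    (t t' : R) :
  open U -> (forall e, U (p e) -> exists2 V, F V & V e) ->
  (forall V, F V -> open V /\ exists s : X -> E,
        [/\ forall y, U y -> {for y, continuous s}, forall y, U y -> V (s y),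
            forall e, V e -> s (p e) = e & forall y, U y -> p (s y) = y]) ->
  nbhs y A -> (forall y' r, A y' -> t <= r <= t' -> U (H (y', r))) ->
  0 <= t -> t <= t' ->
  stopped_lift y t -> stopped_lift y t'.
Proof.
move=> oU cF hF nA AU t0 tt [N [L [oN Ny L0 HL]]].
have ULt : U (p (L (y, t))).
  have [/= -> _] := HL (y, t) Ny; rewrite minxx.
  by apply: AU; [exact: nbhs_singleton | rewrite lexx].
have [V FV Vyt] := cF _ ULt.
have [oV [s [cs sV sp ps]]] := hF _ FV.
have nV : nbhs y [set y' | V (L (y', t))].
  have cL := (HL (y, t) Ny).2.
  have : {for y, continuous (fun y' => L (y', t))}.
    apply: (@continuous_comp _ _ _ (fun y' => (y', t)) L) => //.
    exact: continuous_pair_left.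
  by move=> cLt; exact: (cLt V (open_nbhs_nbhs (conj oV Vyt))).
have nN : nbhs y N by exact: open_nbhs_nbhs.
pose M := [set y' | [/\ N y', A y' & V (L (y', t))]].
have nM : nbhs y M.
  by apply: filterS (filterI nN (filterI nA nV)) => y' [? [? ?]].
exists (M°)%classic,
  (fun z => if z.2 <= t then L z else s (H (z.1, Num.min z.2 t'))).
split; [exact: open_interior | exact: nM | |].
  by move=> y' /nbhs_singleton[Ny' _ _] /=; rewrite t0; exact: L0.
move=> [y' r] /= /nbhs_singleton[Ny' Ay' Vy'].
have UH : t <= r -> U (H (y', Num.min r t')).
  by move=> tr; apply: AU => //; rewrite le_min tr tt ge_min lexx orbT.
split.
  case: leP => rt.
    by have [-> _] := HL (y', r) Ny'; rewrite /= !min_l// (le_trans rt).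
  by rewrite ps//; exact/UH/ltW.
apply: (@continuous_at_glue R _ _ snd t L
  (fun z => s (H (z.1, Num.min z.2 t')))).
- exact: cvg_snd.
- by move=> _; exact: (HL (y', r) Ny').2.
- move=> tr; apply: (@continuous_comp _ _ _
    (fun z : Y * R => H (z.1, Num.min z.2 t')) s); last exact/cs/UH.
  by apply: continuous_comp; [exact: continuous_stop|exact: cH].
- move=> /= rt; rewrite rt in UH *; rewrite (min_l tt).
  by have [+ _] := HL (y', t) Ny'; rewrite /= minxx => <-; rewrite sp.
Qed.

(** [H] sends a box around [(y, t0)] into an evenly covered set. Within the time interval of the
    box, lifts extend forward by [stopped_lift_extend] and restrict backward by
    [stopped_lift_le]. *)
Let stopped_lift_near (y : Y) (t0 : R) : 0 <= t0 ->
  exists2 e : R, 0 < e & forall t t', `|t - t0| < e -> `|t' - t0| < e ->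
    0 <= t -> 0 <= t' -> stopped_lift y t -> stopped_lift y t'.
Proof.
move=> t00.
have [U [F [oU Ux cF _ hF]]] := covering_sheets (H (y, t0)).
have : nbhs (y, t0) (H @^-1` U) by apply: cH; exact: open_nbhs_nbhs.
move=> [[A B] /= [nA nB] ABU].
have [e e0 eB] : exists2 e : R, 0 < e & forall r, `|r - t0| < e -> B r.
  have /nbhs_ballP[e e0 eB] := nB; exists e => // r re; apply: eB.
  by rewrite /ball /= distrC.
exists e => // t t' te t'e t_ge0 t'_ge0; have [tt|/ltW tt] := leP t' t.
  exact: (stopped_lift_le t'_ge0 tt).
apply: (@stopped_lift_extend y U F A t t' oU cF hF nA) => // y' r Ay'.
move=> /andP[tr rt'].
apply: (ABU (y', r)); split => //=; apply: eB.
by move: te t'e; rewrite !ltr_norml => /andP[? ?] /andP[? ?]; apply/andP; lra.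
Qed.

Let stopped_lift1 (y : Y) : stopped_lift y 1.
Proof.
(* Replacing the time [r] by [Num.max 0 r] gives a locally constant property on the whole line,
   which holds at [0]. *)
have -> : 1 = Num.max 0 1 :> R by rewrite max_r// ler01.
apply: (@locally_constant_prop R (fun r => stopped_lift y (Num.max 0 r)) _ 0).
  move=> r; have m0 u : 0 <= Num.max 0 u :> R by rewrite le_max lexx.
  have [e e0 He] := stopped_lift_near y (m0 r).
  have cm : {for r, continuous (fun u : R => Num.max 0 u)}.
    apply: (@continuous_max _ R (fun _ => 0) id); last exact: cvg_id.
    exact: cvg_cst.
  have : \forall u \near r, `|Num.max 0 u - Num.max 0 r| < e.
    by have /cvgr_distC_lt := cm; apply.
  by apply: filterS => u ue; split; apply: He; rewrite ?subrr ?normr0.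
rewrite maxxx; exists setT, (fun z => h0 z.1); split => // [|z _].
  exact: openT.
split; first by apply: ph0; rewrite ge_min lexx orbT.
by apply: continuous_comp; [exact: cvg_fst|exact: ch0].
Qed.

(** The local lifts around the various [y] agree where they overlap, by uniqueness on each line
    [{y'} x R], so they glue. *)
Lemma covering_line_homotopy_lifting : exists L : Y * R -> E,
  [/\ continuous L, forall y, L (y, 0) = h0 y &
      forall y r, p (L (y, r)) = H (y, Num.min r 1)].
Proof.
have /choice[N /choice[L NL]] := stopped_lift1.
have fiber y y' : N y y' -> continuous (fun r => L y (y', r)).
  move=> Ny' r; have [_ _ _ /(_ (y', r) Ny')[_ cL]] := NL y.
  apply: (@continuous_comp _ _ _ (fun r => (y', r)) (L y)) => //.
  exact: continuous_pair_right.
have NN y : N y y by have [] := NL y.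
(* Over each point use its own local lift; near [(y, r)] the result coincides with the single
   continuous map [L y]. *)
exists (fun z => L z.1 z); split => [[y r]|y|y r].
- have [oN Ny L0 HL] := NL y.
  have nN : nbhs (y, r) [set z | N y z.1].
    by apply: (@cvg_fst _ _ (nbhs y) (nbhs r)); exact: open_nbhs_nbhs.
  apply: (@cvg_trans _ (L y @ (y, r))); last exact: (HL (y, r) Ny).2.
  apply: near_eq_cvg; apply: filterS nN => -[y' r'] /= Ny'.
  apply: (@covering_line_lift_unique R (fun u => L y (y', u))
    (fun u => L y' (y', u))).
  + exact: fiber.
  + exact: fiber.
  + move=> u /=; have [-> _] := HL (y', u) Ny'.
    by have [_ _ _ /(_ (y', u) (NN y'))[-> _]] := NL y'.
  + by rewrite L0//; have [_ _ ->] := NL y'.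
- by have [_ _ ->] := NL y.
- by have [_ _ _ /(_ (y, r) (NN y))[-> _]] := NL y.
Qed.

End homotopy_lifting.

Section unit_interval_lifting.
Context (R : realType).
Local Notation I := (unitI R).

Lemma covering_lift_unique (a b : I -> E) :
  continuous a -> continuous b -> p \o a =1 p \o b -> a zero = b zero -> a =1 b.
Proof.
move=> ca cb pab ab0 t; rewrite -(clampK t).
apply: (@covering_line_lift_unique R (a \o @clamp R) (b \o @clamp R)) => //.
- exact: continuous_compf (@clamp_continuous R) ca.
- exact: continuous_compf (@clamp_continuous R) cb.
- by move=> r; exact: pab.
Qed.

Lemma covering_homotopy_lifting (Y : topologicalType) (H : Y * I -> X)
    (h0 : Y -> E) :
  continuous H -> continuous h0 -> (forall y, p (h0 y) = H (y, zero)) ->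
  exists L : Y * I -> E, [/\ continuous L, forall y, L (y, zero) = h0 y &
    forall z, p (L z) = H z].
Proof.
move=> cH ch0 ph0.
have [|y r r0|L [cL L0 pL]] := @covering_line_homotopy_lifting R Y
  (fun z => H (z.1, clamp z.2)) h0 _ ch0.
- apply: (continuous_compf _ cH); apply: continuous_pairf continuous_fst _.
  exact: continuous_compf continuous_snd (@clamp_continuous R).
- by rewrite ph0 /=; congr (H (_, _)); apply: unitv_inj; rewrite unitv0 clamp0.
exists (fun z => L (z.1, unitv z.2)); split => [|y|[y t]].
- apply: (continuous_compf _ cL); apply: continuous_pairf continuous_fst _.
  exact: continuous_compf continuous_snd (@unitv_continuous R).
- by rewrite unitv0 L0.
- by rewrite pL /= min_l ?unitv_le1// clampK.
Qed.

End unit_interval_lifting.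
End covering.

(** * Lifts of paths and contraction of the universal cover *)

Section covering_paths.
Context {R : realType} {E X : topologicalType} (p : E -> X).
Hypothesis covp : covering_map p.
Local Notation I := (unitI R).

(** Lift the homotopy as a square whose side at path time [zero] is constant at [a zero]. By
    uniqueness of lifts, two opposite sides are [a] and [b], and the side joining their ends, which
    lifts a constant path, is constant. *)
Lemma covering_homotopic_lifts (a b : I -> E) :
  continuous a -> continuous b -> a zero = b zero ->
  homotopic_rel R endpoints (p \o a) (p \o b) -> a one = b one.
Proof.
move=> ca cb ab0 [K [cK K0 K1 KA]].
have [||s|L [cL L0 pL]] := @covering_homotopy_lifting _ _ p covp R I
  (fun z => K (z.2, z.1)) (fun _ => a zero).
- apply: (continuous_compf _ cK).
  exact: continuous_pairf continuous_snd continuous_fst.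
- exact: cst_continuous.
- by rewrite /= KA//; left.
have cLs s : continuous (fun t => L (s, t)).
  exact: continuous_compf (@continuous_pair_right _ _ s) cL.
have cLt t : continuous (fun s => L (s, t)).
  exact: continuous_compf (@continuous_pair_left _ _ t) cL.
transitivity (L (zero, one)).
  apply/esym; apply: (covering_lift_unique covp (cLs zero) ca) => [t|] /=.
    by rewrite pL K0.
  exact: L0.
transitivity (L (one, one)).
  apply/esym.
  apply: (covering_lift_unique covp (cLt one) (b := cst _)) => [|s|//].
    exact: cst_continuous.
  by rewrite /= !pL /= !KA//; right.
apply: (covering_lift_unique covp (cLs one) cb) => [t|] /=.
  by rewrite pL K1.
by rewrite L0.
Qed.

(** Local path connectedness passes to [E]: a short path downstairs is carried to the sheet of [e]
    by the local inverse of [p]. *)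
Lemma covering_near_path (e : E) (O : set E) :
  locally_path_connected R X -> nbhs e O ->
  \forall e' \near e, exists d : {path I from e to e'}, range d `<=` O.
Proof.
move=> lpcX nO.
have [cp _ _] := covp.
have [U [F [oU Ux cF _ hF]]] := covering_sheets covp (p e).
have [V FV Ve] := cF e Ux.
have [oV [s [cs sV sp ps]]] := hF V FV.
have nD : nbhs (p e) (U `&` s @^-1` O).
  apply: filterI; first exact: open_nbhs_nbhs.
  by apply: cs => //; rewrite sp.
have [W [oW We WD Wc]] := lpcX (p e) _ (@open_interior _ _) nD.
have nV : nbhs e V by exact: open_nbhs_nbhs.
have nW : nbhs e (p @^-1` W) by apply: cp; exact: open_nbhs_nbhs.
apply: filterS (filterI nV nW) => e' [Ve' We'].
have [d dW] := Wc.2 _ _ We We'.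
have dD t : (U `&` s @^-1` O) (d t).
  by apply: nbhs_singleton; apply: WD; apply: dW; exists t.
have csd : continuous (s \o d).
  move=> t; apply: continuous_comp; first exact: cts_fun.
  exact: cs (dD t).1.
have sd0 : (s \o d) zero = e by rewrite /= path_zero sp.
have sd1 : (s \o d) one = e' by rewrite /= path_one sp.
by exists (mk_path csd sd0 sd1) => _ [t _ <-]; exact: (dD t).2.
Qed.

Lemma dpp_universal_cover_contractible :
  good R X -> dpp R X -> simply_connected R E -> contractible R E.
Proof.
move=> gX [g [cg gK]] [[[e0 _] pcE] scE].
have [cp _ _] := covp.
pose gam e : {path I from e0 to e} := projT1 (cid (pcE e0 e Logic.I Logic.I)).
pose phi e := path_class (image_path cp (gam e)).
have cphi : continuous phi.
  apply: continuous_path_class => // [e d d'|e O nO].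
    exact/image_path_class/pi1_trivial_path_class.
  by apply: covering_near_path => //; case: gX.
have cH : continuous (fun z : E * I => g (phi z.1) z.2).
  exact: (@continuous_path_eval R _ _ (g \o phi) (continuous_compf cphi cg)).
have [|e|L [cL L0 pL]] :=
    covering_homotopy_lifting covp (h0 := fun _ => e0) cH.
- exact: cst_continuous.
- have [/= -> _] := path_class_endpoints (gK (phi e)).
  by rewrite /mk_path path_zero.
exists e0; apply: homotopic_rel_sym; exists L; split => // e.
transitivity (gam e one); last exact: path_one.
(* The lifted distinguished path and [gam e] both start at [e0] and have homotopic images, since [g]
   is a choice map; hence both end at [e]. *)
apply: (@covering_homotopic_lifts (fun t => L (e, t)) (gam e)).
- exact: continuous_compf (@continuous_pair_right _ _ e) cL.
- exact: cts_fun.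
- by rewrite L0 path_zero.
- have /path_classP := gK (phi e); congr homotopic_rel.
  by apply/funext => t; rewrite /= pL.
Qed.

End covering_paths.

(** * Cubes *)

Section cube_geometry.
Context {R : realType} {n : nat}.
Local Notation I := (unitI R).
Implicit Types (a b c : cube R n).

Lemma continuous_coord (i : 'I_n) : continuous (fun c => c i).
Proof. exact: (@proj_continuous _ (fun _ : 'I_n => I) i). Qed.

Lemma continuous_cube (S : topologicalType) (f : S -> cube R n) :
  (forall i, continuous (fun s => f s i)) -> continuous f.
Proof.
move=> cf s; apply/cvg_sup => i.
exact: (@continuous_comp_initial _ _ _ (fun c : cube R n => c i) f (cf i)).
Qed.

(** Convex combination; [clamp] truncates nothing here and only supplies the membership in
    [[0, 1]]. *)
Definition cube_mix (s : I) a b : cube R n :=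
  fun i => clamp ((1 - unitv s) * unitv (a i) + unitv s * unitv (b i)).

Lemma continuous_cube_mix (S : topologicalType) (s : S -> I)
    (a b : S -> cube R n) :
  continuous s -> continuous a -> continuous b ->
  continuous (fun x => cube_mix (s x) (a x) (b x)).
Proof.
move=> cs ca cb; apply: continuous_cube => i.
have cu (h : S -> I) : continuous h -> continuous (fun x => unitv (h x)).
  by move=> ch; exact: continuous_compf ch (@unitv_continuous R).
have cai := cu _ (continuous_compf ca (@continuous_coord i)).
have cbi := cu _ (continuous_compf cb (@continuous_coord i)).
apply: (continuous_compf _ (@clamp_continuous R)) => x.
apply: (@continuousD R R^o S (fun x => (1 - unitv (s x)) * unitv (a x i))
  (fun x => unitv (s x) * unitv (b x i))).
  apply: (@continuousM R S (fun x => 1 - unitv (s x))); last exact: cai.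
  by apply: (@continuousB R R^o S (cst 1)); [exact: cvg_cst|exact: cu].
by apply: (@continuousM R S (fun x => unitv (s x))); [exact: cu|exact: cbi].
Qed.

Lemma cube_mix0 a b : cube_mix zero a b = a.
Proof.
by apply/funext => i; rewrite /cube_mix unitv0 subr0 mul1r mul0r addr0 clampK.
Qed.

Lemma cube_mix1 a b : cube_mix one a b = b.
Proof.
by apply/funext => i; rewrite /cube_mix unitv1 subrr mul1r mul0r add0r clampK.
Qed.

Lemma cube_mixxx s a : cube_mix s a a = a.
Proof.
by apply/funext => i; rewrite /cube_mix -mulrDl subrK mul1r clampK.
Qed.

Lemma continuous_cube_segment a b : continuous (fun t => cube_mix t a b).
Proof.
by apply: continuous_cube_mix; [|exact: cst_continuous..] => t; exact: cvg_id.
Qed.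

Definition cube_segment a b : {path I from a to b} :=
  mk_path (@continuous_cube_segment a b) (cube_mix0 a b) (cube_mix1 a b).

(** The cube is convex, so the straight-line homotopy works. *)
Lemma cube_path_class a b (d d' : {path I from a to b}) :
  path_class d = path_class d'.
Proof.
apply/path_classP; exists (fun z => cube_mix z.2 (d z.1) (d' z.1)).
split => [|t|t|t s].
- apply: continuous_cube_mix; first exact: continuous_snd.
  + exact: continuous_compf continuous_fst (@cts_fun _ _ d).
  + exact: continuous_compf continuous_fst (@cts_fun _ _ d').
- exact: cube_mix0.
- exact: cube_mix1.
- by move=> [->|->] /=; rewrite ?path_zero ?path_one cube_mixxx.
Qed.

(** A tube argument: the constant segment at [a] lies in [O], so by compactness of [I] the whole
    segment from [a] to [b] does for [b] near [a]. *)
Lemma cube_near_path a (O : set (cube R n)) : nbhs a O ->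
  \forall b \near a, exists d : {path I from a to b}, range d `<=` O.
Proof.
move=> nO.
have : \forall b \near a, [set: I] `<=` [set t | O (cube_mix t a b)].
  have /compact_near_coveringP cov := @compact_unitI R.
  apply: (cov _ (nbhs a) (fun b t => O (cube_mix t a b)) _) => t _.
  have : continuous (fun z : I * cube R n => cube_mix z.1 a z.2).
    apply: continuous_cube_mix; [exact: continuous_fst| |exact: continuous_snd].
    exact: cst_continuous.
  by move=> /(_ (t, a)); rewrite /continuous_at /= cube_mixxx; apply.
apply: filterS => b Ob; exists (cube_segment a b) => _ [t _ <-]; exact: Ob.
Qed.

(** The dilation of ratio [1 + 2 s] about the centre of the cube, followed by the coordinatewise
    retraction onto the cube. Here [clamp] does truncate. *)
Definition cube_dilate (s : I) c : cube R n :=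
  fun i => clamp (unitv (c i) + unitv s * (2 * unitv (c i) - 1)).

Lemma continuous_cube_dilate :
  continuous (fun z : cube R n * I => cube_dilate z.2 z.1).
Proof.
apply: continuous_cube => i.
have cc : continuous (fun z : cube R n * I => unitv (z.1 i)).
  apply: (continuous_compf _ (@unitv_continuous R)).
  exact: continuous_compf continuous_fst (@continuous_coord i).
apply: (continuous_compf _ (@clamp_continuous R)) => x.
apply: (@continuousD R R^o (cube R n * I)%type (fun z => unitv (z.1 i))
  (fun z => unitv z.2 * (2 * unitv (z.1 i) - 1))); first exact: cc.
apply: (@continuousM R (cube R n * I)%type (fun z => unitv z.2)).
  exact: continuous_compf continuous_snd (@unitv_continuous R) x.
exact: (@continuous_affine _ R _ 2 (-1) cc x).
Qed.

Lemma cube_dilate0 c : cube_dilate zero c = c.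
Proof.
by apply/funext => i; rewrite /cube_dilate unitv0 mul0r addr0 clampK.
Qed.

Lemma cube_dilate_boundary s c :
  cube_boundary c -> cube_boundary (cube_dilate s c).
Proof.
have s0 := unitv_ge0 s.
move=> [i ci]; exists i; rewrite /cube_dilate; case: ci => ->.
  by left; apply: unitv_inj; rewrite unitv0 clamp0//; lra.
by right; apply: unitv_inj; rewrite unitv1 clamp1//; lra.
Qed.

(* On the middle third cube, [cube_outer] is nonpositive and
   [cube_dilate one] is the dilation c |-> 3 c - 1; outside of it,
   [cube_dilate one] takes values in the boundary. *)
Definition cube_outer c : R :=
  \big[Order.max/ -1]_(i < n)
    Num.max (1 - 3 * unitv (c i)) (3 * unitv (c i) - 2).

Lemma continuous_cube_outer : continuous cube_outer.
Proof.
rewrite /cube_outer; elim: (index_enum _) => [|i s IH].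
  rewrite (_ : (fun c => _) = cst (-1)); first exact: cst_continuous.
  by apply/funext => c; rewrite big_nil.
have cc : continuous (fun c => unitv (c i)).
  exact: continuous_compf (@continuous_coord i) (@unitv_continuous R).
pose h c := Num.max (1 - 3 * unitv (c i)) (3 * unitv (c i) - 2).
have ch : continuous h.
  move=> c; apply: (@continuous_max _ _ (fun c => 1 - 3 * unitv (c i))).
    rewrite (_ : (fun c => _) = (fun c => -3 * unitv (c i) + 1)).
      exact: continuous_affine.
    by apply/funext => b; rewrite addrC mulNr.
  exact: (@continuous_affine _ R _ 3 (-2) cc c).
rewrite (_ : (fun c => _) = h \max (fun c => \big[Order.max/ -1]_(i <- s)
    Num.max (1 - 3 * unitv (c i)) (3 * unitv (c i) - 2))); last first.
  by apply/funext => c; rewrite big_cons.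
by move=> c; apply: continuous_max; [exact: ch | exact: IH].
Qed.

(** If no coordinate of the dilated point is an endpoint, every [c i] lies strictly between 1/3 and
    2/3, so the maximum is negative. *)
Lemma cube_dilate1_boundary c :
  0 <= cube_outer c -> cube_boundary (cube_dilate one c).
Proof.
move=> c0; apply/not_existsP => nb.
suff : cube_outer c < 0 by rewrite ltNge c0.
apply: bigmax_lt => [|i _]; first lra.
rewrite ltNge le_max; apply/negP => /orP[ci|ci]; apply: (nb i).
  left; apply: unitv_inj; rewrite unitv0 /cube_dilate unitv1 clamp0//; lra.
right; apply: unitv_inj; rewrite unitv1 /cube_dilate unitv1 clamp1//; lra.
Qed.

(** Hence the collar parameter [clamp (cube_outer c)] is [one] on the boundary, where the
    null-homotopy of the distinguished loop has ended. *)
Lemma cube_outer_boundary c : cube_boundary c -> 1 <= cube_outer c.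
Proof.
move=> [i ci].
apply: (@le_trans _ _ (Num.max (1 - 3 * unitv (c i)) (3 * unitv (c i) - 2))).
  by case: ci => ->; rewrite ?unitv0 ?unitv1 le_max; apply/orP;
    [left|right]; lra.
exact: (le_bigmax (-1)
  (fun i => Num.max (1 - 3 * unitv (c i)) (3 * unitv (c i) - 2)) i).
Qed.

End cube_geometry.

Lemma exists_ord_neq (n : nat) (i : 'I_n) :
  (2 <= n)%N -> exists j : 'I_n, j != i.
Proof.
by case: n i => [|[|n]]// i _; exists (lift i ord0); rewrite eq_sym neq_lift.
Qed.

(** * Contracting cube maps relative to the boundary *)

Section cube_maps.
Context {R : realType} {X : topologicalType} {n : nat}.
Local Notation I := (unitI R).
Context (f : cube R n -> X) (cf : continuous f) (x : X).
Hypothesis fx : forall c, cube_boundary c -> f c = x.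

Let origin : cube R n := fun=> zero.

(* The boundary of the cube contains a path from the origin to c: first move
   along the i-th axis, with c i an endpoint of the unit interval, then
   along the others. *)
Lemma image_segment_boundary (c : cube R n) : (2 <= n)%N -> cube_boundary c ->
  path_class (image_path cf (cube_segment origin c)) =
  path_class (cst x : path_space R X).
Proof.
move=> n2 [i ci].
have [j ij] := exists_ord_neq i n2.
(* Coordinate [i] runs from 0 to [c i] during the first half of the time, all the others during the
   second half. *)
pose h (t : I) : cube R n := fun k =>
  clamp (unitv (clamp (if k == i then 2 * unitv t else 2 * unitv t - 1)) *
         unitv (c k)).
have hE t k : h t k = clamp (unitv (clamp
  (if k == i then 2 * unitv t else 2 * unitv t - 1)) * unitv (c k)) by [].
have ch : continuous h.
  apply: continuous_cube => k; rewrite /h.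
  have cid : continuous (@id I) by move=> t.
  pose u t := clamp (if k == i then 2 * unitv t else 2 * unitv t - 1) : I.
  have cu : continuous u.
    by rewrite /u; case: (k == i);
      [exact: continuous_clamp2 | exact: continuous_clamp21].
  apply: (continuous_compf _ (@clamp_continuous R)) => t.
  apply: (@continuousM R I (unitv \o u) (cst (unitv (c k)))).
    exact: continuous_compf cu (@unitv_continuous R) t.
  exact: cst_continuous.
have h0 : h zero = origin.
  apply/funext => k; apply: unitv_inj; rewrite /h unitv0.
  rewrite (@clamp0 _ (if _ then _ else _)); last by case: ifP => _; lra.
  by rewrite mul0r clamp0// unitv0.
have h1 : h one = c.
  apply/funext => k; rewrite /h unitv1.
  rewrite (@clamp1 _ (if _ then _ else _)); last by case: ifP => _; lra.
  by rewrite mul1r clampK.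
transitivity (path_class (image_path cf (mk_path ch h0 h1))).
  exact/image_path_class/cube_path_class.
apply: eq_path_class => t; apply: fx; rewrite /mk_path.
(* In the first half another coordinate [j], available because [2 <= n], is still 0; in the second
   half coordinate [i] rests at the endpoint [c i]. *)
have [t2|/ltW t2] := leP (unitv t) 2^-1; [exists j; left|exists i].
  rewrite [LHS]hE (negbTE ij); apply: unitv_inj.
  by rewrite unitv0 (@clamp0 _ (2 * _ - 1)) ?mul0r ?clamp0//; lra.
suff hti : h t i = c i by move: ci; rewrite -hti.
by rewrite hE eqxx (@clamp1 _ (2 * _)) ?mul1r ?clampK//; lra.
Qed.

Lemma dpp_cube_map_homotopic : (2 <= n)%N -> good R X -> dpp R X ->
  homotopic_rel R (@cube_boundary R n) f (cst x).
Proof.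
move=> n2 gX [g [cg gK]].
pose phi c := path_class (image_path cf (cube_segment origin c)).
have cphi : continuous phi.
  apply: continuous_path_class => // [c d d'|c O nO].
    exact/image_path_class/cube_path_class.
  exact: cube_near_path.
pose G (z : cube R n * I) := g (phi z.1) z.2.
have cG : continuous G.
  exact: (@continuous_path_eval R _ _ (g \o phi) (continuous_compf cphi cg)).
have G0 c : G (c, zero) = x.
  have [Gc _] := path_class_endpoints (gK (phi c)).
  transitivity (f origin).
    exact: etrans Gc
      (@path_zero _ _ _ _ (image_path cf (cube_segment origin c))).
  apply: fx.
  by exists (Ordinal (ltnW n2)); left.
have G1 c : G (c, one) = f c.
  have [_ Gc] := path_class_endpoints (gK (phi c)).
  exact: etrans Gc (@path_one _ _ _ _ (image_path cf (cube_segment origin c))).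
pose l := g (path_class (cst x : path_space R X)).
have Gl c t : cube_boundary c -> G (c, t) = l t.
  by move=> bc; rewrite /G /phi image_segment_boundary.
have /path_classP[M [cM M0 M1 ME]] :
  path_class l = path_class (cst x : path_space R X) by exact: gK.
(* The square [M] is [l] on the side [s = zero] and [x] on the three other sides. *)
have Mx u s : endpoints u -> M (u, s) = x.
  by move=> eu; rewrite ME// -M0 -[RHS](M1 u) !ME.
have cdilate s : continuous (fun c : cube R n => cube_dilate s c).
  exact: continuous_compf (@continuous_pair_left _ _ s)
    (@continuous_cube_dilate R n).
(* First squeeze [f] into the middle third cube by growing the dilation; the collar is then sent to
   [x]. *)
apply: (@homotopic_rel_trans _ _ _ _ _ (f \o @cube_dilate R n one)).
  exists (fun z => f (cube_dilate z.2 z.1)); split => // [|c|c s bc].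
  - exact: continuous_compf (@continuous_cube_dilate R n) cf.
  - by rewrite /= cube_dilate0.
  - by rewrite /= !fx//; exact: cube_dilate_boundary.
apply: homotopic_rel_sym.
(* Run from the constant: distinguished paths on the middle cube, and the null-homotopy of [l] on
   the collar, with [cube_outer] as its parameter. Where [cube_outer] vanishes the dilated point is
   on the boundary, so both pieces follow [l]. *)
exists (fun z => if cube_outer z.1 <= 0 then G (cube_dilate one z.1, z.2)
                 else M (z.2, clamp (cube_outer z.1))).
have cd : continuous (fun z : cube R n * I => cube_outer z.1).
  exact: continuous_compf continuous_fst (@continuous_cube_outer R n).
split => [|c|c|c t bc].
- apply: continuous_glue => //.
  + apply: (continuous_compf _ cG); apply: continuous_pairf continuous_snd.
    exact: continuous_compf continuous_fst (cdilate one).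
  + apply: (continuous_compf _ cM); apply: continuous_pairf continuous_snd _.
    exact: continuous_compf cd (@clamp_continuous R).
  + move=> [c t] /= c0; rewrite Gl; first by rewrite c0 -M0.
    by apply: cube_dilate1_boundary; rewrite c0.
- by rewrite /= G0 Mx ?if_same//; left.
- rewrite /= G1 Mx; last by right.
  by case: leP => // /ltW c0; rewrite fx//; exact: cube_dilate1_boundary.
- have c1 := cube_outer_boundary bc.
  rewrite /= ifF; last by apply/negbTE; rewrite -ltNge; lra.
  by rewrite (_ : clamp _ = one) ?M1//; apply: unitv_inj; rewrite unitv1 clamp1.
Qed.

End cube_maps.

Lemma dpp_aspherical (R : realType) (X : topologicalType) :
  good R X -> dpp R X -> aspherical R X.
Proof.
move=> gX dX; split; first by case: gX.
move=> n x n2; rewrite /homotopy_group_trivial /homotopy_group.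
elim/quotW => -[f fx]; apply/eqmodP/asboolP => /=.
apply: dpp_cube_map_homotopic => //; first exact: cts_fun.
exact/asboolP.
Qed.

Theorem theorem2p8 (R : realType) (X : topologicalType)
    (X_good : good R X) (X_dpp : dpp R X) :
  (forall (E : topologicalType) (p : E -> X),
     universal_cover R p -> contractible R E) /\
  aspherical R X.
Proof.
split; last exact: dpp_aspherical.
by move=> E p [covp scE]; exact: (dpp_universal_cover_contractible covp).
Qed.
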